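(* Let $n\geq2$ and let $\gamma(t)=(x(t),r(t))$ be a solution of the system $$\dot x=\cos\theta,\qquad \dot r=\sin\theta,\qquad \dot\theta=\frac{x}{2}\sin\theta+\Big(\frac{n-1}{r}-\frac{r}{2}\Big)\cos\theta$$ in $\{r>0\}$. Then neither of the functions $x(t)$ and $r(t)-\sqrt{2(n-1)}$ has a positive local minimum or a negative local maximum; in particular, each of these functions has different signs at successive critical points.
   Context: Here $t$ is Euclidean arc length and $\theta$ is the angle between $\dot\gamma$ and the $x$-axis. *)

(* Defs.v *)
From Stdlib Require Import Reals.
From Coquelicot Require Import Coquelicot.
Open Scope R_scope.

(* t lies in the open interval (a, b), endpoints possibly infinite *)
Definition in_ival (a b : Rbar) (t : R) : Prop := Rbar_lt a t /\ Rbar_lt t b.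

Definition is_solution (n : nat) (a b : Rbar) (x r th : R -> R) : Prop :=
  forall t, in_ival a b t ->
    0 < r t /\
    is_derive x t (cos (th t)) /\
    is_derive r t (sin (th t)) /\
    is_derive th t (x t / 2 * sin (th t) + ((INR n - 1) / r t - r t / 2) * cos (th t)).

Definition is_local_min (a b : Rbar) (f : R -> R) (t : R) : Prop :=
  in_ival a b t /\
  exists eps : R, 0 < eps /\
    forall s, in_ival a b s -> Rabs (s - t) < eps -> f t <= f s.

Definition is_local_max (a b : Rbar) (f : R -> R) (t : R) : Prop :=
  in_ival a b t /\
  exists eps : R, 0 < eps /\
    forall s, in_ival a b s -> Rabs (s - t) < eps -> f s <= f t.

Definition no_pos_min_no_neg_max (a b : Rbar) (f : R -> R) : Prop :=
  (forall t, is_local_min a b f t -> f t <= 0) /\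
  (forall t, is_local_max a b f t -> 0 <= f t).

(* Main.v *)
Require Import Defs.
From Stdlib Require Import Reals Lra Psatz.
From Coquelicot Require Import Coquelicot.
Open Scope R_scope.

(** Both [x] and [r - sqrt (2 (n - 1))] satisfy [f'' = - k f] with [k > 0] at their
    critical points: where [x' = cos θ = 0] the equation for [θ] gives
    [x'' = - sin θ θ' = - x / 2], and where [r' = sin θ = 0] it gives
    [r'' = cos θ θ' = (n - 1) / r - r / 2 = - (r + c) (r - c) / (2 r)] with
    [c = sqrt (2 (n - 1))].  At a positive local minimum the first and second
    derivative tests would force [f' = 0] and [f'' >= 0], contradicting [f'' < 0];
    negative local maxima are excluded symmetrically. *)

Lemma in_ival_nbhd a b t eps : in_ival a b t -> 0 < eps ->
  exists del, 0 < del /\ del <= eps /\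
    forall s, Rabs (s - t) < del -> in_ival a b s.
Proof.
  intros [Ha Hb] Heps.
  assert (HA : exists da, 0 < da /\ forall s, Rabs (s - t) < da -> Rbar_lt a s).
  { destruct a as [a0| |]; simpl in Ha; try contradiction.
    - exists (t - a0). split; [lra|]. intros s Hs. apply Rabs_def2 in Hs. simpl; lra.
    - exists 1. split; [lra|]. intros; simpl; auto. }
  assert (HB : exists db, 0 < db /\ forall s, Rabs (s - t) < db -> Rbar_lt s b).
  { destruct b as [b0| |]; simpl in Hb; try contradiction.
    - exists (b0 - t). split; [lra|]. intros s Hs. apply Rabs_def2 in Hs. simpl; lra.
    - exists 1. split; [lra|]. intros; simpl; auto. }
  destruct HA as [da [Hda HA]], HB as [db [Hdb HB]].
  exists (Rmin eps (Rmin da db)).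
  pose proof (Rmin_l eps (Rmin da db)); pose proof (Rmin_r eps (Rmin da db)).
  pose proof (Rmin_l da db); pose proof (Rmin_r da db).
  split; [|split; [assumption|]].
  - repeat apply Rmin_pos; assumption.
  - intros s Hs. split; [apply HA | apply HB]; lra.
Qed.

Lemma is_local_max_opp a b f t :
  is_local_max a b f t -> is_local_min a b (fun s => - f s) t.
Proof.
  intros [Ht [eps [Heps Hmax]]]. split; [assumption|].
  exists eps. split; [assumption|].
  intros s Hs Hst. specialize (Hmax s Hs Hst). lra.
Qed.

Section FirstAndSecondDerivativeTests.

Variables (a b : Rbar) (f g : R -> R).
Hypothesis f_deriv : forall s, in_ival a b s -> is_derive f s (g s).

Lemma local_min_deriv_eq0 t : is_local_min a b f t -> g t = 0.
Proof.
  intros [Ht [eps [Heps Hmin]]].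
  destruct (in_ival_nbhd a b t eps Ht Heps) as [del [Hdel [Hle Hnear]]].
  pose (pr := exist (fun l => derivable_pt_lim f t l) (g t)
                (proj1 (is_derive_Reals _ _ _) (f_deriv t Ht)) : derivable_pt f t).
  change (derive_pt f t pr = 0).
  apply (deriv_minimum f (t - del) (t + del)); try lra.
  intros s Hs1 Hs2.
  assert (Hst : Rabs (s - t) < del) by (apply Rabs_def1; lra).
  apply Hmin; [apply Hnear | ]; lra.
Qed.

Lemma local_min_second_deriv_ge0 t d :
  is_local_min a b f t -> is_derive g t d -> 0 <= d.
Proof.
  intros Hmin Hg.
  assert (Hg0 : g t = 0) by exact (local_min_deriv_eq0 t Hmin).
  destruct Hmin as [Ht [eps [Heps Hmin]]].
  destruct (Rle_or_lt 0 d) as [|Hd]; [assumption | exfalso].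
  destruct (proj1 (is_derive_Reals _ _ _) Hg (- d) ltac:(lra)) as [dl Hdl].
  destruct (in_ival_nbhd a b t (Rmin eps dl) Ht) as [del [Hdel [Hle Hnear]]].
  { apply Rmin_pos; [lra | apply cond_pos]. }
  pose proof (Rmin_l eps dl); pose proof (Rmin_r eps dl).
  destruct (MVT_cor2 f g t (t + del / 2)) as [c [Hfc Hc]]; [lra | |].
  { intros c Hc. apply is_derive_Reals, f_deriv, Hnear. apply Rabs_def1; lra. }
  (* [g] vanishes at [t] and decreases there, so it is negative just to the right *)
  assert (Hgc : g c < 0).
  { assert (Hct : Rabs (c - t) < dl) by (apply Rabs_def1; lra).
    specialize (Hdl (c - t) ltac:(lra) Hct).
    replace (t + (c - t)) with c in Hdl by ring.
    rewrite Hg0, Rminus_0_r in Hdl. apply Rabs_def2 in Hdl.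
    assert (Hq : g c / (c - t) < 0) by lra.
    destruct (Rlt_or_le (g c) 0) as [|Hgc]; [assumption | exfalso].
    assert (0 <= g c / (c - t)).
    { apply Rmult_le_pos; [assumption |]. left. apply Rinv_0_lt_compat. lra. }
    lra. }
  assert (f t <= f (t + del / 2)).
  { apply Hmin; [apply Hnear |]; apply Rabs_def1; lra. }
  assert (g c * (t + del / 2 - t) < 0) by (apply Rmult_neg_pos; lra).
  lra.
Qed.

End FirstAndSecondDerivativeTests.

Lemma no_pos_min_no_neg_max_of_restoring a b (f g dg : R -> R) :
  (forall s, in_ival a b s -> is_derive f s (g s)) ->
  (forall s, in_ival a b s -> is_derive g s (dg s)) ->
  (forall s, in_ival a b s -> g s = 0 -> exists k, 0 < k /\ dg s = - k * f s) ->
  no_pos_min_no_neg_max a b f.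
Proof.
  intros Hf Hg Hrestore. split.
  - intros t Hmin.
    pose proof (local_min_deriv_eq0 a b f g Hf t Hmin) as Hcrit.
    pose proof (local_min_second_deriv_ge0 a b f g Hf t (dg t) Hmin
                  (Hg t (proj1 Hmin))) as Hconvex.
    destruct (Hrestore t (proj1 Hmin) Hcrit) as [k [Hk Hdg]].
    nra.
  - intros t Hmax.
    pose proof (is_local_max_opp a b f t Hmax) as Hmin.
    assert (Hf' : forall s, in_ival a b s -> is_derive (fun s => - f s) s (- g s)).
    { intros s Hs. apply (is_derive_opp f), Hf, Hs. }
    pose proof (local_min_deriv_eq0 a b _ _ Hf' t Hmin) as Hcrit.
    pose proof (local_min_second_deriv_ge0 a b _ _ Hf' t (- dg t) Hmin
                  (is_derive_opp g t _ (Hg t (proj1 Hmax)))) as Hconcave.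
    destruct (Hrestore t (proj1 Hmax) ltac:(lra)) as [k [Hk Hdg]].
    nra.
Qed.

Section Solution.

Variables (n : nat) (a b : Rbar) (x r th : R -> R).
Hypothesis sol : is_solution n a b x r th.

Let dth s := x s / 2 * sin (th s) + ((INR n - 1) / r s - r s / 2) * cos (th s).

Lemma is_derive_cos_theta s :
  in_ival a b s -> is_derive (fun t => cos (th t)) s (- sin (th s) * dth s).
Proof.
  intros Hs. destruct (sol s Hs) as [_ [_ [_ Hth]]].
  replace (- sin (th s) * dth s) with (scal (dth s) (- sin (th s)))
    by (unfold scal; simpl; unfold mult; simpl; ring).
  apply (is_derive_comp cos th), Hth. apply is_derive_cos.
Qed.

Lemma is_derive_sin_theta s :
  in_ival a b s -> is_derive (fun t => sin (th t)) s (cos (th s) * dth s).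
Proof.
  intros Hs. destruct (sol s Hs) as [_ [_ [_ Hth]]].
  replace (cos (th s) * dth s) with (scal (dth s) (cos (th s)))
    by (unfold scal; simpl; unfold mult; simpl; ring).
  apply (is_derive_comp sin th), Hth. apply is_derive_sin.
Qed.

Lemma x_no_pos_min_no_neg_max : no_pos_min_no_neg_max a b x.
Proof.
  apply (no_pos_min_no_neg_max_of_restoring a b x (fun t => cos (th t))
           (fun t => - sin (th t) * dth t)).
  - intros s Hs. apply sol, Hs.
  - exact is_derive_cos_theta.
  - intros s _ Hcos. exists (1 / 2). split; [lra |].
    pose proof (sin2_cos2 (th s)) as Hpyth. unfold Rsqr in Hpyth.
    assert (Hsin2 : sin (th s) * sin (th s) = 1) by (rewrite Hcos in Hpyth; lra).
    unfold dth. rewrite Hcos.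
    transitivity (- (sin (th s) * sin (th s)) * (x s / 2)); [ring |].
    rewrite Hsin2. field.
Qed.

Lemma r_shift_no_pos_min_no_neg_max : (1 <= n)%nat ->
  no_pos_min_no_neg_max a b (fun t => r t - sqrt (2 * (INR n - 1))).
Proof.
  intros Hn. set (c := sqrt (2 * (INR n - 1))).
  assert (Hn1 : 0 <= INR n - 1) by (apply le_INR in Hn; simpl in Hn; lra).
  assert (Hc0 : 0 <= c) by apply sqrt_pos.
  assert (Hcc : c * c = 2 * (INR n - 1)) by (apply sqrt_sqrt; lra).
  apply (no_pos_min_no_neg_max_of_restoring a b _ (fun t => sin (th t))
           (fun t => cos (th t) * dth t)).
  - intros s Hs. destruct (sol s Hs) as [_ [_ [Hr _]]].
    replace (sin (th s)) with (minus (sin (th s)) zero)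
      by (unfold minus, plus, opp, zero; simpl; ring).
    exact (is_derive_minus r (fun _ => c) s _ _ Hr (is_derive_const c s)).
  - exact is_derive_sin_theta.
  - intros s Hs Hsin. destruct (sol s Hs) as [Hr _].
    exists ((r s + c) / (2 * r s)). split.
    + apply Rdiv_lt_0_compat; lra.
    + pose proof (sin2_cos2 (th s)) as Hpyth. unfold Rsqr in Hpyth.
      assert (Hcos2 : cos (th s) * cos (th s) = 1) by (rewrite Hsin in Hpyth; lra).
      unfold dth. rewrite Hsin.
      transitivity ((cos (th s) * cos (th s)) * ((INR n - 1) / r s - r s / 2)); [ring |].
      rewrite Hcos2. replace (INR n - 1) with (c * c / 2) by lra. field. lra.
Qed.

End Solution.

Theorem lemma8 (n : nat) (a b : Rbar) (x r th : R -> R) :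
  (2 <= n)%nat ->
  is_solution n a b x r th ->
  no_pos_min_no_neg_max a b x /\
  no_pos_min_no_neg_max a b (fun t => r t - sqrt (2 * (INR n - 1))).
Proof.
  intros Hn Hsol. split.
  - exact (x_no_pos_min_no_neg_max n a b x r th Hsol).
  - apply (r_shift_no_pos_min_no_neg_max n a b x r th Hsol). lia.
Qed.
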